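(* Consider the fully-discrete path-conservative discontinuous Galerkin schemes for still water equilibria in one and two space dimensions, obtained from the spatial operators $\mathrm{RHS}^S_j$ (1D) and $\mathrm{RHS}^S_{ij}$ (2D) defined in the context by the third-order SSP Runge–Kutta method: given $\boldsymbol v^n\in\boldsymbol{\mathcal V}_h^k$ and $\Delta t>0$, find $\boldsymbol v^{(1)},\boldsymbol v^{(2)},\boldsymbol v^{n+1}\in\boldsymbol{\mathcal V}_h^k$ such that on every cell $K$ and for every $\boldsymbol\varphi\in\boldsymbol{\mathcal V}_h^k$ $$\int_K\boldsymbol v^{(1)}\cdot\boldsymbol\varphi=\int_K\boldsymbol v^n\cdot\boldsymbol\varphi+\Delta t\,\mathrm{RHS}^S_K(\boldsymbol v^n,b,\boldsymbol\varphi),$$ $$\int_K\boldsymbol v^{(2)}\cdot\boldsymbol\varphi=\tfrac34\int_K\boldsymbol v^n\cdot\boldsymbol\varphi+\tfrac14\Big(\int_K\boldsymbol v^{(1)}\cdot\boldsymbol\varphi+\Delta t\,\mathrm{RHS}^S_K(\boldsymbol v^{(1)},b,\boldsymbol\varphi)\Big),$$ $$\int_K\boldsymbol v^{n+1}\cdot\boldsymbol\varphi=\tfrac13\int_K\boldsymbol v^n\cdot\boldsymbol\varphi+\tfrac23\Big(\int_K\boldsymbol v^{(2)}\cdot\boldsymbol\varphi+\Delta t\,\mathrm{RHS}^S_K(\boldsymbol v^{(2)},b,\boldsymbol\varphi)\Big),$$ where $K=\mathcal I_j$, $\mathrm{RHS}^S_K=\mathrm{RHS}^S_j$ in 1D and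 $K=\mathcal I_{ij}$, $\mathrm{RHS}^S_K=\mathrm{RHS}^S_{ij}$ in 2D. These schemes are exact for still water equilibrium states: if the initial datum $\boldsymbol v^0$ has $h_1$ and $w$ constant on the whole domain and all discharges equal to zero ($m_1=m_2=0$ in 1D; $m_1=n_1=m_2=n_2=0$ in 2D), then $\boldsymbol v^n=\boldsymbol v^0$ for all $n\ge 0$.
   Context: **Constants and unknowns.** $g>0$ is the gravitational acceleration, $0<r<1$ the density ratio. $b$ is a given time-independent bottom topography, smooth in each cell, with one-sided traces at cell interfaces (possibly discontinuous there). $h_1>0$ is the upper-layer depth, $w=h_2+b$ with lower-layer depth $h_2=w-b>0$; $m_i=h_iu_i$ (and in 2D $n_i=h_iv_i$) are discharges, with $u_i$, $v_i$ the velocities of layer $i$ in the $x$- and $y$-directions. Still water equilibrium: $h_1=$ constant, $w=$ constant, zero velocities. **Mesh and spaces.** 1D: the domain is divided into cells $\mathcal I_j=[x_{j-1/2},x_{j+1/2}]$, $j=1,\dots,nx$. 2D: rectangular cells $\mathcal I_{ij}=[x_{i-1/2},x_{i+1/2}]\times[y_{j-1/2},y_{j+1/2}]$. $\mathcal W_h^k$ is the space of functions whose restriction to each cell is a polynomial of degree at most $k$; $\boldsymbol{\mathcal V}_h^k$ is the space of vectors with all $l$ components in $\mathcal W_h^k$ ($l=4$ in 1D, $l=6$ in 2D). Superscripts $-$/$+$ denote the left/right (resp. lower/upper) limits at a cell interface. At the boundary of the domain, exterior traces of $\boldsymbol v$ are supplied by boundary conditions compatible with the equilibrium (e.g. periodic,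 or free boundary conditions copying the interior state), so for a globally constant $\boldsymbol v$ they equal the same constant. All integrals are exact. **1D operator.** $\boldsymbol v=(h_1,m_1,w,m_2)^T$, $$\boldsymbol f(\boldsymbol v)=\Big(m_1,\ \tfrac{m_1^2}{h_1}+\tfrac12 gh_1^2,\ m_2,\ \tfrac{m_2^2}{w-b}+\tfrac12 gw^2\Big)^T,$$ and $\mathcal G(\boldsymbol v)$ is the $4\times4$ matrix whose only nonzero entries are $\mathcal G_{23}=gh_1$, $\mathcal G_{41}=gr(w-b)$, $\mathcal G_{43}=-gb$. Then $$\mathrm{RHS}^S_j=\int_{\mathcal I_j}\boldsymbol f(\boldsymbol v)\cdot\boldsymbol\varphi_x\,dx-\widehat{\boldsymbol f}_{j+\frac12}\cdot\boldsymbol\varphi^-_{j+\frac12}+\widehat{\boldsymbol f}_{j-\frac12}\cdot\boldsymbol\varphi^+_{j-\frac12}-\int_{\mathcal I_j}\mathcal G(\boldsymbol v)\boldsymbol v_x\cdot\boldsymbol\varphi\,dx-\tfrac12\boldsymbol\varphi^-_{j+\frac12}\cdot\boldsymbol{\mathfrak g}_{j+\frac12}-\tfrac12\boldsymbol\varphi^+_{j-\frac12}\cdot\boldsymbol{\mathfrak g}_{j-\frac12},$$ with the Lax–Friedrichs flux $$\widehat{\boldsymbol f}_{j+\frac12}=\tfrac12\big(\boldsymbol f(\boldsymbol v^-_{j+\frac12})+\boldsymbol f(\boldsymbol v^+_{j+\frac12})\big)-\tfrac{\alpha}{2}\big(\boldsymbol v^+_{j+\frac12}-\boldsymbol v^-_{j+\frac12}\big),$$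 where each one-sided $\boldsymbol f$ uses the trace of $b$ from the same side and $\alpha$ is the global maximum of the moduli of the eigenvalues of $\partial\boldsymbol f/\partial\boldsymbol v$; and the path integral $$\boldsymbol{\mathfrak g}_{j+\frac12}=\int_0^1\mathcal G(\boldsymbol\phi_{j+\frac12}(\tau))\,\tfrac{\partial}{\partial\tau}\boldsymbol\phi_{j+\frac12}(\tau)\,d\tau,\qquad \boldsymbol\phi_{j+\frac12}(\tau)=\boldsymbol v^-_{j+\frac12}+\tau(\boldsymbol v^+_{j+\frac12}-\boldsymbol v^-_{j+\frac12}),$$ where the value of $b$ in $\mathcal G$ along the path is the linear interpolation $b^-+\tau(b^+-b^-)$. **2D operator.** $\boldsymbol v=(h_1,m_1,n_1,w,m_2,n_2)^T$, $$\boldsymbol f_1=\Big(m_1,\tfrac{m_1^2}{h_1}+\tfrac12gh_1^2,\tfrac{m_1n_1}{h_1},m_2,\tfrac{m_2^2}{w-b}+\tfrac12gw^2,\tfrac{m_2n_2}{w-b}\Big)^T,$$ $$\boldsymbol f_2=\Big(n_1,\tfrac{m_1n_1}{h_1},\tfrac{n_1^2}{h_1}+\tfrac12gh_1^2,n_2,\tfrac{m_2n_2}{w-b},\tfrac{n_2^2}{w-b}+\tfrac12gw^2\Big)^T.$$ $\mathcal G_1$ is the $6\times6$ matrix with only nonzero entries $(2,4)$: $gh_1$; $(5,1)$: $gr(w-b)$; $(5,4)$: $-gb$. $\mathcal G_2$ has only nonzero entries $(3,4)$: $gh_1$; $(6,1)$: $gr(w-b)$; $(6,4)$: $-gb$.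 Then $$\begin{aligned}\mathrm{RHS}^S_{ij}=&\iint_{\mathcal I_{ij}}\boldsymbol f_1\cdot\boldsymbol\varphi_x\,dxdy-\int_{y_{j-1/2}}^{y_{j+1/2}}\Big(\widehat{\boldsymbol f_1}_{i+\frac12,j}\cdot\boldsymbol\varphi(x^-_{i+\frac12},y)-\widehat{\boldsymbol f_1}_{i-\frac12,j}\cdot\boldsymbol\varphi(x^+_{i-\frac12},y)\Big)dy\\ &+\iint_{\mathcal I_{ij}}\boldsymbol f_2\cdot\boldsymbol\varphi_y\,dxdy-\int_{x_{i-1/2}}^{x_{i+1/2}}\Big(\widehat{\boldsymbol f_2}_{i,j+\frac12}\cdot\boldsymbol\varphi(x,y^-_{j+\frac12})-\widehat{\boldsymbol f_2}_{i,j-\frac12}\cdot\boldsymbol\varphi(x,y^+_{j-\frac12})\Big)dx\\ &-\iint_{\mathcal I_{ij}}\mathcal G_1\boldsymbol v_x\cdot\boldsymbol\varphi\,dxdy-\int_{y_{j-1/2}}^{y_{j+1/2}}\Big(\tfrac12\boldsymbol\varphi(x^-_{i+\frac12},y)\cdot\boldsymbol{\mathfrak g}_{1,i+\frac12,j}+\tfrac12\boldsymbol\varphi(x^+_{i-\frac12},y)\cdot\boldsymbol{\mathfrak g}_{1,i-\frac12,j}\Big)dy\\ &-\iint_{\mathcal I_{ij}}\mathcal G_2\boldsymbol v_y\cdot\boldsymbol\varphi\,dxdy-\int_{x_{i-1/2}}^{x_{i+1/2}}\Big(\tfrac12\boldsymbol\varphi(x,y^-_{j+\frac12})\cdot\boldsymbol{\mathfrak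 g}_{2,i,j+\frac12}+\tfrac12\boldsymbol\varphi(x,y^+_{j-\frac12})\cdot\boldsymbol{\mathfrak g}_{2,i,j-\frac12}\Big)dx.\end{aligned}$$ Here $\widehat{\boldsymbol f_1},\widehat{\boldsymbol f_2}$ are the Lax–Friedrichs fluxes at each point of an edge, $\tfrac12(\boldsymbol f_d(\boldsymbol v^-)+\boldsymbol f_d(\boldsymbol v^+))-\tfrac{\alpha_d}2(\boldsymbol v^+-\boldsymbol v^-)$, with $\alpha_d$ the global maximum modulus of the eigenvalues of $\partial\boldsymbol f_d/\partial\boldsymbol v$, and $\boldsymbol{\mathfrak g}_{d}=\int_0^1\mathcal G_d(\boldsymbol\phi(\tau))\boldsymbol\phi'(\tau)\,d\tau$ along the segment $\boldsymbol\phi(\tau)=\boldsymbol v^-+\tau(\boldsymbol v^+-\boldsymbol v^-)$ between the two traces at that point of the edge (with $b$ linearly interpolated), $d=1,2$. *)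

(* Defs.v *)
From HB Require Import structures.
From mathcomp Require Import all_boot all_order all_algebra complex.
From mathcomp Require Import polyXY.
From mathcomp Require Import all_classical all_reals all_analysis.

Set Implicit Arguments.
Unset Strict Implicit.
Unset Printing Implicit Defensive.

Import Order.TTheory GRing.Theory Num.Theory.
Import numFieldNormedType.Exports.

Local Open Scope classical_set_scope.
Local Open Scope ring_scope.

Definition dot (R : realType) (l : nat) (u w : 'rV[R]_l) : R :=
  \sum_i u 0 i * w 0 i.

Definition vec (R : realType) (l : nat) (s : seq R) : 'rV[R]_l :=
  \row_(i < l) s`_i.

(* C^oo on D: every iterated directional derivative is differentiable on D. *)
Definition smooth_on (R : realType) (V : normedModType R) (D : set V)
    (f : V -> R) : Prop :=
  forall (s : seq V) (p : V), D p ->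
    differentiable (foldr (fun u (F : V -> R) => fun q => 'D_u F q) f s) p.

(* The moduli of the (possibly complex) eigenvalues of the Jacobian of F at u.
   jacobian is the transpose of the usual matrix (dF_i/du_j), which has the
   same eigenvalues. *)
Definition jac_eig_moduli (R : realType) (l : nat)
    (F : 'rV[R]_l -> 'rV[R]_l) (u : 'rV[R]_l) : set R :=
  [set ComplexField.Normc.normc z | z in
    [set z : R[i] | eigenvalue (map_mx (real_complex R) ('J F u)) z]].

Definition lax_friedrichs (R : realType) (l : nat)
    (F : R -> 'rV[R]_l -> 'rV[R]_l) (alpha bm bp : R) (vm vp : 'rV[R]_l) :
    'rV[R]_l :=
  2^-1 *: (F bm vm + F bp vp) - (alpha / 2) *: (vp - vm).

(* States are row vectors, so that the product G w of a matrix and a column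
   vector reads w *m G^T. *)
Definition path_integral (R : realType) (l : nat)
    (G : R -> 'rV[R]_l -> 'M[R]_l) (bm bp : R) (vm vp : 'rV[R]_l) : 'rV[R]_l :=
  let path (t : R) := vm + t *: (vp - vm) in
  \row_i \int[lebesgue_measure]_(t in `[0, 1])
    (derive1 path t *m (G (bm + t * (bp - bm)) (path t))^T) 0 i.

(* One step v -> v' of SSP-RK3 with stages v1 and v2, in weak form: C is the
   set of cells, V contains the discrete space Vh, mass K v phi is the integral
   over K of v . phi and rhs K v phi is the spatial operator. *)
Definition ssprk3_step (R : realType) (V C : Type) (Vh : set V)
    (mass rhs : C -> V -> V -> R) (dt : R) (v v1 v2 v' : V) : Prop :=
  [/\ Vh v1, Vh v2, Vh v' &
    forall (K : C) (phi : V), Vh phi ->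
    [/\ mass K v1 phi = mass K v phi + dt * rhs K v phi,
        mass K v2 phi = 3 / 4 * mass K v phi
                        + 1 / 4 * (mass K v1 phi + dt * rhs K v1 phi) &
        mass K v' phi = 1 / 3 * mass K v phi
                        + 2 / 3 * (mass K v2 phi + dt * rhs K v2 phi)]].

(* Components 0, 1, 2, 3 of a state are h1, m1, w, m2. *)
Definition flux (R : realType) (g b : R) (u : 'rV[R]_4) : 'rV[R]_4 :=
  let h1 := u 0 0 in let m1 := u 0 1 in let w := u 0 2 in let m2 := u 0 3 in
  vec 4 [:: m1; m1 ^+ 2 / h1 + 2^-1 * g * h1 ^+ 2;
            m2; m2 ^+ 2 / (w - b) + 2^-1 * g * w ^+ 2].

Definition Gmx (R : realType) (g r b : R) (u : 'rV[R]_4) : 'M[R]_4 :=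
  let h1 := u 0 0 in let w := u 0 2 in
  (g * h1) *: delta_mx 1 2 + (g * r * (w - b)) *: delta_mx 3 0
  - (g * b) *: delta_mx 3 2.

(* Broken vector polynomials: one polynomial vector per cell, whose values at
   the end points of the closed cell are the one-sided traces. *)
Definition bpoly1 (R : realType) (nx : nat) : Type := 'I_nx -> 'rV[{poly R}]_4.

Definition Vh1 (R : realType) (nx k : nat) : set (bpoly1 R nx) :=
  [set v : bpoly1 R nx | forall j i, (size (v j 0%R i) <= k.+1)%N].

Definition ev1 (R : realType) (l : nat) (p : 'rV[{poly R}]_l) (x : R) :
    'rV[R]_l :=
  \row_i (p 0 i).[x].

Definition dev1 (R : realType) (l : nat) (p : 'rV[{poly R}]_l) (x : R) :
    'rV[R]_l :=
  \row_i (deriv (p 0 i)).[x].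

(* Interfaces are numbered 0..nx; cell j lies between the interfaces
   lft j = j and rgt j = j + 1. *)
Definition lft (n : nat) (j : 'I_n) : 'I_n.+1 := lift ord_max j.
Definition rgt (n : nat) (j : 'I_n) : 'I_n.+1 := lift ord0 j.

Definition seg (R : realType) (n : nat) (x : 'I_n.+1 -> R) (j : 'I_n) : set R :=
  `[x (lft j), x (rgt j)].

(* Mesh, bottom and boundary data. bot1 j is the bottom on the closed cell j,
   its values at the end points being the one-sided traces; botL1, botR1 are
   the exterior traces of the bottom and extL1, extR1 those of v supplied by
   the boundary conditions. *)
Record problem1 (R : realType) (nx : nat) := Problem1 {
  node1 : 'I_nx.+1 -> R;
  node1_lt : forall j : 'I_nx, node1 (lft j) < node1 (rgt j);
  bot1 : 'I_nx -> R -> R;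
  bot1_smooth : forall j,
    smooth_on `]node1 (lft j), node1 (rgt j)[%classic (bot1 j);
  bot1_traces : forall j, {within seg node1 j, continuous (bot1 j)};
  botL1 : R;
  botR1 : R;
  extL1 : bpoly1 R nx -> 'rV[R]_4;
  extR1 : bpoly1 R nx -> 'rV[R]_4;
  ext1_const : forall (v : bpoly1 R nx) (c : 'rV[R]_4),
    (forall j x, seg node1 j x -> ev1 (v j) x = c) ->
    extL1 v = c /\ extR1 v = c
}.

(* Left (-) and right (+) traces at an interface; unlift finds the adjacent
   cell, if there is one. *)
Definition vm1 (R : realType) (nx : nat) (P : problem1 R nx) (v : bpoly1 R nx)
    (a : 'I_nx.+1) : 'rV[R]_4 :=
  if unlift ord0 a is Some j then ev1 (v j) (node1 P a) else extL1 P v.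

Definition vp1 (R : realType) (nx : nat) (P : problem1 R nx) (v : bpoly1 R nx)
    (a : 'I_nx.+1) : 'rV[R]_4 :=
  if unlift ord_max a is Some j then ev1 (v j) (node1 P a) else extR1 P v.

Definition bm1 (R : realType) (nx : nat) (P : problem1 R nx) (a : 'I_nx.+1) :
    R :=
  if unlift ord0 a is Some j then bot1 P j (node1 P a) else botL1 P.

Definition bp1 (R : realType) (nx : nat) (P : problem1 R nx) (a : 'I_nx.+1) :
    R :=
  if unlift ord_max a is Some j then bot1 P j (node1 P a) else botR1 P.

Definition alpha1 (R : realType) (g : R) (nx : nat) (P : problem1 R nx)
    (v : bpoly1 R nx) : R :=
  sup [set a | exists (j : 'I_nx) (x : R), seg (node1 P) j x /\
                 jac_eig_moduli (flux g (bot1 P j x)) (ev1 (v j) x) a].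

Definition fhat1 (R : realType) (g : R) (nx : nat) (P : problem1 R nx)
    (v : bpoly1 R nx) (a : 'I_nx.+1) : 'rV[R]_4 :=
  lax_friedrichs (flux g) (alpha1 g P v)
    (bm1 P a) (bp1 P a) (vm1 P v a) (vp1 P v a).

Definition gpath1 (R : realType) (g r : R) (nx : nat) (P : problem1 R nx)
    (v : bpoly1 R nx) (a : 'I_nx.+1) : 'rV[R]_4 :=
  path_integral (Gmx g r) (bm1 P a) (bp1 P a) (vm1 P v a) (vp1 P v a).

Definition mass1 (R : realType) (nx : nat) (P : problem1 R nx) (j : 'I_nx)
    (v phi : bpoly1 R nx) : R :=
  \int[lebesgue_measure]_(x in seg (node1 P) j)
    dot (ev1 (v j) x) (ev1 (phi j) x).

Definition rhs1 (R : realType) (g r : R) (nx : nat) (P : problem1 R nx)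
    (j : 'I_nx) (v phi : bpoly1 R nx) : R :=
  let phim := ev1 (phi j) (node1 P (rgt j)) in
  let phip := ev1 (phi j) (node1 P (lft j)) in
  \int[lebesgue_measure]_(x in seg (node1 P) j)
    dot (flux g (bot1 P j x) (ev1 (v j) x)) (dev1 (phi j) x)
  - dot (fhat1 g P v (rgt j)) phim
  + dot (fhat1 g P v (lft j)) phip
  - \int[lebesgue_measure]_(x in seg (node1 P) j)
      dot (dev1 (v j) x *m (Gmx g r (bot1 P j x) (ev1 (v j) x))^T)
          (ev1 (phi j) x)
  - 2^-1 * dot phim (gpath1 g r P v (rgt j))
  - 2^-1 * dot phip (gpath1 g r P v (lft j)).

(* Components 0, ..., 5 of a state are h1, m1, n1, w, m2, n2. *)
Definition flux_x (R : realType) (g b : R) (u : 'rV[R]_6) : 'rV[R]_6 :=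
  let h1 := u 0 0 in let m1 := u 0 1 in let n1 := u 0 2 in
  let w := u 0 3 in let m2 := u 0 4 in let n2 := u 0 5 in
  vec 6 [:: m1; m1 ^+ 2 / h1 + 2^-1 * g * h1 ^+ 2; m1 * n1 / h1;
            m2; m2 ^+ 2 / (w - b) + 2^-1 * g * w ^+ 2; m2 * n2 / (w - b)].

Definition flux_y (R : realType) (g b : R) (u : 'rV[R]_6) : 'rV[R]_6 :=
  let h1 := u 0 0 in let m1 := u 0 1 in let n1 := u 0 2 in
  let w := u 0 3 in let m2 := u 0 4 in let n2 := u 0 5 in
  vec 6 [:: n1; m1 * n1 / h1; n1 ^+ 2 / h1 + 2^-1 * g * h1 ^+ 2;
            n2; m2 * n2 / (w - b); n2 ^+ 2 / (w - b) + 2^-1 * g * w ^+ 2].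

Definition Gmx_x (R : realType) (g r b : R) (u : 'rV[R]_6) : 'M[R]_6 :=
  let h1 := u 0 0 in let w := u 0 3 in
  (g * h1) *: delta_mx 1 3 + (g * r * (w - b)) *: delta_mx 4 0
  - (g * b) *: delta_mx 4 3.

Definition Gmx_y (R : realType) (g r b : R) (u : 'rV[R]_6) : 'M[R]_6 :=
  let h1 := u 0 0 in let w := u 0 3 in
  (g * h1) *: delta_mx 2 3 + (g * r * (w - b)) *: delta_mx 5 0
  - (g * b) *: delta_mx 5 3.

(* As in polyXY, the outer variable of {poly {poly R}} is x, the inner one y. *)
Definition bpoly2 (R : realType) (nx ny : nat) : Type :=
  'I_nx -> 'I_ny -> 'rV[{poly {poly R}}]_6.

(* Degree means total degree. *)
Definition Vh2 (R : realType) (nx ny k : nat) : set (bpoly2 R nx ny) :=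
  [set v : bpoly2 R nx ny | forall i j c (a b : nat), (k < a + b)%N -> (v i j 0%R c)`_a`_b = 0].

Definition ev2 (R : realType) (l : nat) (p : 'rV[{poly {poly R}}]_l)
    (x y : R) : 'rV[R]_l :=
  \row_i (p 0 i).[x, y].

Definition dxev2 (R : realType) (l : nat) (p : 'rV[{poly {poly R}}]_l)
    (x y : R) : 'rV[R]_l :=
  \row_i (deriv (p 0 i)).[x, y].

Definition dyev2 (R : realType) (l : nat) (p : 'rV[{poly {poly R}}]_l)
    (x y : R) : 'rV[R]_l :=
  \row_i (map_poly (@deriv R) (p 0 i)).[x, y].

Record problem2 (R : realType) (nx ny : nat) := Problem2 {
  nodex : 'I_nx.+1 -> R;
  nodey : 'I_ny.+1 -> R;
  nodex_lt : forall i : 'I_nx, nodex (lft i) < nodex (rgt i);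
  nodey_lt : forall j : 'I_ny, nodey (lft j) < nodey (rgt j);
  bot2 : 'I_nx -> 'I_ny -> R -> R -> R;
  bot2_smooth : forall i j,
    smooth_on (`]nodex (lft i), nodex (rgt i)[ `*`
               `]nodey (lft j), nodey (rgt j)[) (fun z => bot2 i j z.1 z.2);
  bot2_traces : forall i j,
    {within seg nodex i `*` seg nodey j,
      continuous (fun z : R * R => bot2 i j z.1 z.2)};
  (* L, R, D, U: left, right, lower and upper sides of the domain *)
  botL2 : 'I_ny -> R -> R;
  botR2 : 'I_ny -> R -> R;
  botD2 : 'I_nx -> R -> R;
  botU2 : 'I_nx -> R -> R;
  extL2 : bpoly2 R nx ny -> 'I_ny -> R -> 'rV[R]_6;
  extR2 : bpoly2 R nx ny -> 'I_ny -> R -> 'rV[R]_6;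
  extD2 : bpoly2 R nx ny -> 'I_nx -> R -> 'rV[R]_6;
  extU2 : bpoly2 R nx ny -> 'I_nx -> R -> 'rV[R]_6;
  ext2_const : forall (v : bpoly2 R nx ny) (c : 'rV[R]_6),
    (forall i j x y, seg nodex i x -> seg nodey j y -> ev2 (v i j) x y = c) ->
    (forall j y, seg nodey j y -> extL2 v j y = c /\ extR2 v j y = c) /\
    (forall i x, seg nodex i x -> extD2 v i x = c /\ extU2 v i x = c)
}.

(* Traces on vertical edges: interface a in x, row j, ordinate y. *)
Definition vmx2 (R : realType) (nx ny : nat) (P : problem2 R nx ny)
    (v : bpoly2 R nx ny) (a : 'I_nx.+1) (j : 'I_ny) (y : R) : 'rV[R]_6 :=
  if unlift ord0 a is Some i then ev2 (v i j) (nodex P a) y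
  else extL2 P v j y.

Definition vpx2 (R : realType) (nx ny : nat) (P : problem2 R nx ny)
    (v : bpoly2 R nx ny) (a : 'I_nx.+1) (j : 'I_ny) (y : R) : 'rV[R]_6 :=
  if unlift ord_max a is Some i then ev2 (v i j) (nodex P a) y
  else extR2 P v j y.

Definition bmx2 (R : realType) (nx ny : nat) (P : problem2 R nx ny)
    (a : 'I_nx.+1) (j : 'I_ny) (y : R) : R :=
  if unlift ord0 a is Some i then bot2 P i j (nodex P a) y else botL2 P j y.

Definition bpx2 (R : realType) (nx ny : nat) (P : problem2 R nx ny)
    (a : 'I_nx.+1) (j : 'I_ny) (y : R) : R :=
  if unlift ord_max a is Some i then bot2 P i j (nodex P a) y else botR2 P j y.

(* Traces on horizontal edges: column i, interface a in y, abscissa x. *)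
Definition vmy2 (R : realType) (nx ny : nat) (P : problem2 R nx ny)
    (v : bpoly2 R nx ny) (i : 'I_nx) (a : 'I_ny.+1) (x : R) : 'rV[R]_6 :=
  if unlift ord0 a is Some j then ev2 (v i j) x (nodey P a)
  else extD2 P v i x.

Definition vpy2 (R : realType) (nx ny : nat) (P : problem2 R nx ny)
    (v : bpoly2 R nx ny) (i : 'I_nx) (a : 'I_ny.+1) (x : R) : 'rV[R]_6 :=
  if unlift ord_max a is Some j then ev2 (v i j) x (nodey P a)
  else extU2 P v i x.

Definition bmy2 (R : realType) (nx ny : nat) (P : problem2 R nx ny)
    (i : 'I_nx) (a : 'I_ny.+1) (x : R) : R :=
  if unlift ord0 a is Some j then bot2 P i j x (nodey P a) else botD2 P i x.

Definition bpy2 (R : realType) (nx ny : nat) (P : problem2 R nx ny)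
    (i : 'I_nx) (a : 'I_ny.+1) (x : R) : R :=
  if unlift ord_max a is Some j then bot2 P i j x (nodey P a) else botU2 P i x.

Definition alpha2 (R : realType) (nx ny : nat) (P : problem2 R nx ny)
    (F : R -> 'rV[R]_6 -> 'rV[R]_6) (v : bpoly2 R nx ny) : R :=
  sup [set a | exists (i : 'I_nx) (j : 'I_ny) (x y : R),
    [/\ seg (nodex P) i x, seg (nodey P) j y &
        jac_eig_moduli (F (bot2 P i j x y)) (ev2 (v i j) x y) a]].

Definition fhatx2 (R : realType) (g : R) (nx ny : nat) (P : problem2 R nx ny)
    (v : bpoly2 R nx ny) (a : 'I_nx.+1) (j : 'I_ny) (y : R) : 'rV[R]_6 :=
  lax_friedrichs (flux_x g) (alpha2 P (flux_x g) v)
    (bmx2 P a j y) (bpx2 P a j y) (vmx2 P v a j y) (vpx2 P v a j y).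

Definition fhaty2 (R : realType) (g : R) (nx ny : nat) (P : problem2 R nx ny)
    (v : bpoly2 R nx ny) (i : 'I_nx) (a : 'I_ny.+1) (x : R) : 'rV[R]_6 :=
  lax_friedrichs (flux_y g) (alpha2 P (flux_y g) v)
    (bmy2 P i a x) (bpy2 P i a x) (vmy2 P v i a x) (vpy2 P v i a x).

Definition gpathx2 (R : realType) (g r : R) (nx ny : nat) (P : problem2 R nx ny)
    (v : bpoly2 R nx ny) (a : 'I_nx.+1) (j : 'I_ny) (y : R) : 'rV[R]_6 :=
  path_integral (Gmx_x g r)
    (bmx2 P a j y) (bpx2 P a j y) (vmx2 P v a j y) (vpx2 P v a j y).

Definition gpathy2 (R : realType) (g r : R) (nx ny : nat) (P : problem2 R nx ny)
    (v : bpoly2 R nx ny) (i : 'I_nx) (a : 'I_ny.+1) (x : R) : 'rV[R]_6 :=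
  path_integral (Gmx_y g r)
    (bmy2 P i a x) (bpy2 P i a x) (vmy2 P v i a x) (vpy2 P v i a x).

Definition cell_int2 (R : realType) (nx ny : nat) (P : problem2 R nx ny)
    (K : 'I_nx * 'I_ny) (F : R -> R -> R) : R :=
  \int[(@lebesgue_measure R \x @lebesgue_measure R)%E]_(z in
    seg (nodex P) K.1 `*` seg (nodey P) K.2) F z.1 z.2.

Definition mass2 (R : realType) (nx ny : nat) (P : problem2 R nx ny)
    (K : 'I_nx * 'I_ny) (v phi : bpoly2 R nx ny) : R :=
  cell_int2 P K (fun x y => dot (ev2 (v K.1 K.2) x y) (ev2 (phi K.1 K.2) x y)).

Definition rhs2 (R : realType) (g r : R) (nx ny : nat) (P : problem2 R nx ny)
    (K : 'I_nx * 'I_ny) (v phi : bpoly2 R nx ny) : R :=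
  let i := K.1 in let j := K.2 in
  let vK := v i j in let phiK := phi i j in let bK := bot2 P i j in
  let phi_l y := ev2 phiK (nodex P (lft i)) y in
  let phi_r y := ev2 phiK (nodex P (rgt i)) y in
  let phi_d x := ev2 phiK x (nodey P (lft j)) in
  let phi_u x := ev2 phiK x (nodey P (rgt j)) in
  cell_int2 P K (fun x y =>
    dot (flux_x g (bK x y) (ev2 vK x y)) (dxev2 phiK x y))
  - \int[lebesgue_measure]_(y in seg (nodey P) j)
      (dot (fhatx2 g P v (rgt i) j y) (phi_r y)
       - dot (fhatx2 g P v (lft i) j y) (phi_l y))
  + cell_int2 P K (fun x y =>
      dot (flux_y g (bK x y) (ev2 vK x y)) (dyev2 phiK x y))
  - \int[lebesgue_measure]_(x in seg (nodex P) i)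
      (dot (fhaty2 g P v i (rgt j) x) (phi_u x)
       - dot (fhaty2 g P v i (lft j) x) (phi_d x))
  - cell_int2 P K (fun x y =>
      dot (dxev2 vK x y *m (Gmx_x g r (bK x y) (ev2 vK x y))^T)
          (ev2 phiK x y))
  - \int[lebesgue_measure]_(y in seg (nodey P) j)
      (2^-1 * dot (phi_r y) (gpathx2 g r P v (rgt i) j y)
       + 2^-1 * dot (phi_l y) (gpathx2 g r P v (lft i) j y))
  - cell_int2 P K (fun x y =>
      dot (dyev2 vK x y *m (Gmx_y g r (bK x y) (ev2 vK x y))^T)
          (ev2 phiK x y))
  - \int[lebesgue_measure]_(x in seg (nodex P) i)
      (2^-1 * dot (phi_u x) (gpathy2 g r P v i (rgt j) x)
       + 2^-1 * dot (phi_d x) (gpathy2 g r P v i (lft j) x)).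

(* Main.v *)
Require Import Defs.
From HB Require Import structures.
From mathcomp Require Import all_boot all_order all_algebra.
From mathcomp Require Import all_classical all_reals all_analysis.
From mathcomp Require Import polyXY measurable_realfun ring.

Set Implicit Arguments.
Unset Strict Implicit.
Unset Printing Implicit Defensive.

Import Order.TTheory GRing.Theory Num.Theory.
Import numFieldNormedType.Exports.

Local Open Scope classical_set_scope.
Local Open Scope ring_scope.

(** A still water state is a constant state, and the scheme does not move a
    constant state [c] whose flux [F b c] does not depend on the bottom [b].
    Still water has this second property because the only terms of the fluxes
    that contain [b] are quotients with vanishing numerators.

    The operator vanishes at such a state for the following reasons.  Both
    traces at every interface equal [c], so the Lax-Friedrichs flux reduces to
    the constant [f = F b c] whatever the numerical viscosity, and the path in
    the nonconservative product is constant, so the path integral is zero.  The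
    volume term [G v_x] is zero since [v_x = 0].  There remains the volume
    integral of [f . phi_x], which cancels the two edge terms by the fundamental
    theorem of calculus; in two dimensions Fubini's theorem reduces each
    direction to the one-dimensional cancellation along lines ([rhs1_const],
    [rhs2_const]).

    With a vanishing operator, every Runge-Kutta stage has the same moments
    against the discrete space as the initial datum.  Moments determine an
    element of this space ([mass1_sep], [mass2_sep]): test the difference of two
    elements against itself, and use that a polynomial which is nonnegative on a
    cell and has integral zero there is the zero polynomial
    ([Rintegral_horner_eq0], [Rintegral_horner2_eq0]).  As elements of the
    discrete space are polynomials and not functions on the cells, this also
    takes the fact that a polynomial with infinitely many roots is zero. *)

(** * Integrals of polynomials in one variable *)

(** The embedding [f] lets the coefficients be polynomials themselves: with
    [f = polyC] this handles [p.[x, y]] as a polynomial in [x] alone. *)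
Lemma negligible_roots (R : realType) (A : idomainType) (f : R -> A)
    (p : {poly A}) : injective f -> p != 0 ->
  (@lebesgue_measure R).-negligible [set x | p.[f x] = 0].
Proof.
move=> finj pn0.
have ctbl : countable [set x | p.[f x] = 0].
  apply/finite_set_countable; apply: contrapT => /(infinite_set_fset (size p)).
  case=> B Bp szB.
  have := @max_poly_roots _ p [seq f x | x <- finmap.enum_fset B] pn0.
  rewrite size_map ltnNge szB => rts; apply: (notF (rts _ _)).
    by apply/allP => _ /mapP[x xB ->]; apply/rootP/Bp.
  by rewrite map_inj_uniq ?finmap.fset_uniq.
apply/negligibleP; last exact: countable_lebesgue_measure0.
exact: countable_measurable.
Qed.

Lemma not_negligible_itv (R : realType) (a b : R) : a < b ->
  ~ (@lebesgue_measure R).-negligible `[a, b].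
Proof.
move=> ab neg.
have : lebesgue_measure (`[a, b]%classic : set R) = 0%E.
  exact: measure_negligible neg.
rewrite lebesgue_measure_itv/= lte_fin ab -EFinB => -[] /eqP.
by rewrite subr_eq0 gt_eqF.
Qed.

Lemma poly_eq0_on_itv (R : realType) (A : idomainType) (f : R -> A) (a b : R)
    (p : {poly A}) :
  injective f -> a < b -> (forall x, x \in `[a, b] -> p.[f x] = 0) -> p = 0.
Proof.
move=> finj ab p0; apply/eqP; apply/negPn/negP => pn0.
apply: (not_negligible_itv ab).
by apply: negligibleS (negligible_roots finj pn0) => x; exact: p0.
Qed.

Lemma integrable_horner (R : realType) (p : {poly R}) (a b : R) :
  (@lebesgue_measure R).-integrable `[a, b] (EFin \o horner p).
Proof.
apply: continuous_compact_integrable; first exact: segment_compact.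
by apply: continuous_subspaceT; exact: continuous_horner.
Qed.

Lemma Rintegral_deriv (R : realType) (p : {poly R}) (a b : R) : a < b ->
  \int[lebesgue_measure]_(x in `[a, b]) p^`().[x] = p.[b] - p.[a].
Proof.
move=> ab; rewrite /Rintegral (@continuous_FTC2 _ _ (horner p))//.
- by apply: continuous_subspaceT; exact: continuous_horner.
- split; first by move=> x _; exact: derivable_horner.
  + by apply: cvg_at_right_filter; exact: continuous_horner.
  + by apply: cvg_at_left_filter; exact: continuous_horner.
- by move=> x _; rewrite derivE.
Qed.

(** The integrand is zero almost everywhere, so if [p] were not zero the
    interval would be covered by a null set and the finitely many roots of
    [p]. *)
Lemma Rintegral_horner_eq0 (R : realType) (p : {poly R}) (a b : R) : a < b ->
  (forall x, x \in `[a, b] -> 0 <= p.[x]) ->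
  \int[lebesgue_measure]_(x in `[a, b]) p.[x] = 0 -> p = 0.
Proof.
move=> ab p0 int0; apply/eqP; apply/negPn/negP => pn0.
have intp := integrable_horner p a b.
have int_abs0 :
    (\int[@lebesgue_measure R]_(x in `[a, b]) `|(EFin \o horner p) x| = 0)%E.
  rewrite -[RHS](congr1 EFin int0) fineK; last exact: integrable_fin_num.
  by apply: eq_integral => x; rewrite inE => xab; rewrite gee0_abs// lee_fin p0.
have ae0 := (ae_eq_integral_abs lebesgue_measure (measurable_itv _)
  (measurable_int _ intp)).1 int_abs0.
have neg0 : (@lebesgue_measure R).-negligible
    (~` [set x | x \in `[a, b] -> (p.[x])%:E = 0%E]) := ae0.
apply: (not_negligible_itv ab).
have negr := negligible_roots (@inj_id R) pn0.
apply: (negligibleS _ (negligibleU neg0 negr)).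
move=> x xab; have [px0|px0] := pselect (p.[x] = 0); first by right.
by left=> /(_ xab) [].
Qed.

(** * Integrals of polynomials in two variables *)

Lemma horner2_MXaddC (R : comNzRingType) (p : {poly {poly R}}) (c : {poly R})
  (x y : R) : (p * 'X + c%:P).[x, y] = p.[x, y] * x + c.[y].
Proof. by rewrite !hornerE. Qed.

Lemma continuous_horner2 (R : realType) (p : {poly {poly R}}) :
  continuous (fun z : R * R => p.[z.1, z.2]).
Proof.
elim/poly_ind: p => [|p c IH] z.
  by under eq_fun do rewrite !horner0; exact: cvg_cst.
under eq_fun do rewrite horner2_MXaddC.
apply: cvgD; first by apply: cvgM; [exact: IH|exact: cvg_fst].
apply: (@continuous_comp _ _ _ snd (horner c)); first exact: cvg_snd.
exact: continuous_horner.
Qed.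

Lemma measurable_horner2 (R : realType) (p : {poly {poly R}}) :
  measurable_fun setT (fun z : R * R => p.[z.1, z.2]).
Proof.
elim/poly_ind: p => [|p c IH].
  by under eq_fun do rewrite !horner0; exact: measurable_cst.
under eq_fun do rewrite horner2_MXaddC.
apply: measurable_funD.
  by apply: measurable_funM; [exact: IH|exact: measurable_fst].
apply: (@measurableT_comp _ _ _ _ _ _ (horner c)); last exact: measurable_snd.
by apply: continuous_measurable_fun; exact: continuous_horner.
Qed.

Lemma integrable_horner2 (R : realType) (p : {poly {poly R}}) (a b c d : R) :
  ((@lebesgue_measure R \x @lebesgue_measure R)%E).-integrable
    (`[a, b] `*` `[c, d]) (fun z : R * R => (p.[z.1, z.2])%:E).
Proof.
apply: (@measurable_bounded_integrable _ _ _
  (@lebesgue_measure R \x @lebesgue_measure R)%E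
  (fun z : R * R => p.[z.1, z.2])).
- exact: measurableX.
- have := @product_measure1E _ _ _ _ _ (@lebesgue_measure R)
    (@lebesgue_measure R) _ _ (measurable_itv `[a, b]) (measurable_itv `[c, d]).
  rewrite /= => ->; rewrite !lebesgue_measure_itv/=.
  by do 2 case: ifP => _; rewrite -?EFinB -?EFinM ?mule0 ?mul0e ?ltry.
- by apply: measurable_funTS; exact: measurable_horner2.
- have /compact_bounded :
      compact ((fun z : R * R => p.[z.1, z.2]) @` (`[a, b] `*` `[c, d])).
    apply: continuous_compact; last first.
      by apply: compact_setX; exact: segment_compact.
    by apply: continuous_subspaceT; exact: continuous_horner2.
  move=> [M [Mr MP]]; exists M; split=> // x Mx z zD; apply: (MP _ Mx).
  by exists z.
Qed.

(** Extension by zero from a rectangle is an iterated extension by zero; this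
    reduces Fubini's theorem on a rectangle to the one on the whole plane. *)
Lemma restrict_rectangle (R : realType) (F : R * R -> \bar R) (A B : set R)
    (x y : R) :
  (F \_ (A `*` B)) (x, y) =
  ((fun x' => ((fun y' => F (x', y')) \_ B) y) \_ A) x.
Proof.
rewrite !patchE in_setX/=.
by case: (x \in A); case: (y \in B).
Qed.

Lemma Rintegral_rectangle (R : realType) (p : {poly {poly R}}) (a b c d : R) :
  \int[(@lebesgue_measure R \x @lebesgue_measure R)%E]_(z in
      `[a, b] `*` `[c, d]) p.[z.1, z.2] =
  \int[lebesgue_measure]_(x in `[a, b])
    \int[lebesgue_measure]_(y in `[c, d]) p.[x, y].
Proof.
congr fine; rewrite integral_mkcond -integral12_prod_meas1; last first.
  apply/(integrable_mkcond _ _).1; first exact: measurableX.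
  exact: integrable_horner2.
rewrite [RHS]integral_mkcond.
apply: (@eq_integral _ _ _ (@lebesgue_measure R)) => x _.
rewrite /fubini_F; under eq_integral do rewrite restrict_rectangle.
rewrite patchE; case: ifPn => xA.
  rewrite fineK; last first.
    exact/integrable_fin_num/(integrable_horner p.[x%:P]).
  rewrite [RHS]integral_mkcond.
  by apply: eq_integral => y _; rewrite !patchE xA.
by rewrite integral0_eq// => y _; rewrite patchE (negbTE xA).
Qed.

Lemma Rintegral_rectangle_swap (R : realType) (p : {poly {poly R}})
    (a b c d : R) :
  \int[(@lebesgue_measure R \x @lebesgue_measure R)%E]_(z in
      `[a, b] `*` `[c, d]) p.[z.1, z.2] =
  \int[lebesgue_measure]_(y in `[c, d])
    \int[lebesgue_measure]_(x in `[a, b]) p.[x, y].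
Proof.
congr fine; rewrite integral_mkcond -integral21_prod_meas1; last first.
  apply/(integrable_mkcond _ _).1; first exact: measurableX.
  exact: integrable_horner2.
rewrite [RHS]integral_mkcond.
apply: (@eq_integral _ _ _ (@lebesgue_measure R)) => y _.
rewrite /fubini_G; under eq_integral do rewrite restrict_rectangle.
rewrite [in RHS]patchE; case: ifPn => yB.
  rewrite fineK; last first.
    under eq_integral do rewrite -horner2_swapXY.
    exact/integrable_fin_num/(integrable_horner (swapXY p).[y%:P]).
  rewrite [RHS]integral_mkcond.
  by apply: eq_integral => x _; rewrite !patchE yB.
by rewrite integral0_eq// => x _; rewrite !patchE (negbTE yB); case: ifP.
Qed.

(** Integrating out one variable leaves a polynomial in the other, so that the
    one-variable results apply to the outer integral of Fubini's theorem. *)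
Lemma Rintegral_horner2 (R : realType) (p : {poly {poly R}}) (c d : R) :
  exists q : {poly R}, forall x,
    \int[lebesgue_measure]_(y in `[c, d]) p.[x, y] = q.[x].
Proof.
elim/poly_ind: p => [|p r [q qE]].
  exists 0 => x; rewrite [RHS]horner0.
  under eq_Rintegral do rewrite !horner0.
  by rewrite Rintegral_cst ?mul0r//; exact: measurable_itv.
exists (q * 'X + (\int[lebesgue_measure]_(y in `[c, d]) r.[y])%:P) => x.
under eq_Rintegral do rewrite horner2_MXaddC.
rewrite (@RintegralD _ _ _ lebesgue_measure)//.
- rewrite (@RintegralZr _ _ _ lebesgue_measure) ?qE ?hornerE//.
  exact: integrable_horner.
- rewrite (_ : EFin \o _ = EFin \o horner (x *: p.[x%:P])).
    exact: integrable_horner.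
  by apply/funext => y /=; rewrite hornerZ mulrC.
- exact: integrable_horner.
Qed.

(** The inner integrals form a nonnegative polynomial with integral zero; hence
    each of them vanishes, and then each section of [p] vanishes. *)
Lemma Rintegral_horner2_eq0 (R : realType) (p : {poly {poly R}})
    (a b c d : R) : a < b -> c < d ->
  (forall x y, x \in `[a, b] -> y \in `[c, d] -> 0 <= p.[x, y]) ->
  \int[(@lebesgue_measure R \x @lebesgue_measure R)%E]_(z in
      `[a, b] `*` `[c, d]) p.[z.1, z.2] = 0 -> p = 0.
Proof.
move=> ab cd p0; have [q qE] := Rintegral_horner2 p c d.
rewrite Rintegral_rectangle; under eq_Rintegral do rewrite qE.
move=> q0; have {}q0 : q = 0.
  apply: (Rintegral_horner_eq0 ab) q0 => x xab; rewrite -qE.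
  by apply: Rintegral_ge0 => y ycd; exact: p0.
apply: (poly_eq0_on_itv (@polyC_inj R) ab) => x xab.
apply: (Rintegral_horner_eq0 cd) => [y ycd|]; first exact: p0.
by rewrite qE q0 horner0.
Qed.

Lemma horner2_eval_inner (R : comNzRingType) (p : {poly {poly R}}) (x y : R) :
  p.[x, y] = (map_poly (horner_eval y) p).[x].
Proof. by rewrite -horner_swapXY horner2_swapXY. Qed.

Lemma horner2_deriv_inner (R : comNzRingType) (p : {poly {poly R}}) (x y : R) :
  (map_poly (@deriv R) p).[x, y] = (p.[x%:P])^`().[y].
Proof.
rewrite (@horner_coef_wide _ (size p) (map_poly _ _)) ?size_poly//.
rewrite (horner_coef p) raddf_sum/= !horner_sum; apply: eq_bigr => i _.
by rewrite coef_map/= derivM -!rmorphXn/= derivC mulr0 addr0.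
Qed.

(** The divergence theorem on a rectangle, one direction at a time: the variable
    of differentiation is taken as the inner variable of Fubini's theorem. *)
Lemma Rintegral_rectangle_derivx (R : realType) (p : {poly {poly R}})
    (a b c d : R) : a < b ->
  \int[(@lebesgue_measure R \x @lebesgue_measure R)%E]_(z in
      `[a, b] `*` `[c, d]) p^`().[z.1, z.2] =
  \int[lebesgue_measure]_(y in `[c, d]) (p.[b, y] - p.[a, y]).
Proof.
move=> ab; rewrite Rintegral_rectangle_swap; apply: eq_Rintegral => y _.
under eq_Rintegral do rewrite horner2_eval_inner -deriv_map.
by rewrite Rintegral_deriv// -!horner2_eval_inner.
Qed.

Lemma Rintegral_rectangle_derivy (R : realType) (p : {poly {poly R}})
    (a b c d : R) : c < d ->
  \int[(@lebesgue_measure R \x @lebesgue_measure R)%E]_(z in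
      `[a, b] `*` `[c, d]) (map_poly (@deriv R) p).[z.1, z.2] =
  \int[lebesgue_measure]_(x in `[a, b]) (p.[x, d] - p.[x, c]).
Proof.
move=> cd; rewrite Rintegral_rectangle; apply: eq_Rintegral => x _.
under eq_Rintegral do rewrite horner2_deriv_inner.
by rewrite Rintegral_deriv.
Qed.

(** * Steady states of the Runge-Kutta method *)

(** The weights of each stage add up to one, so when [rhs] vanishes at [v] every
    stage has the moments of [v]; the first hypothesis turns this into an
    equality of discrete functions. *)
Lemma ssprk3_step_stationary (R : realType) (V C : Type) (Vh : set V)
    (mass rhs : C -> V -> V -> R) (dt : R) (v v1 v2 v' : V) :
  (forall u, Vh u ->
     (forall K phi, Vh phi -> mass K u phi = mass K v phi) -> u = v) ->
  (forall K phi, rhs K v phi = 0) ->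
  ssprk3_step Vh mass rhs dt v v1 v2 v' -> v' = v.
Proof.
move=> sep rhs0 [Vh1 Vh2 Vh' step].
have v1E : v1 = v.
  by apply: sep => // K phi /(step K)[-> _ _]; rewrite rhs0 mulr0 addr0.
have v2E : v2 = v.
  apply: sep => // K phi /(step K)[_ -> _].
  by rewrite v1E rhs0 mulr0 addr0; field.
apply: sep => // K phi /(step K)[_ _ ->].
by rewrite v2E rhs0 mulr0 addr0; field.
Qed.

(** * Fluxes and path integrals at a constant state *)

Lemma Rintegral_eq0 d (T : measurableType d) (R : realType)
    (mu : {measure set T -> \bar R}) (D : set T) (f : T -> R) :
  (forall x, D x -> f x = 0) -> \int[mu]_(x in D) f x = 0.
Proof. by move=> f0; rewrite /Rintegral integral0_eq// => x Dx; rewrite f0. Qed.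

Lemma dot0l (R : realType) (l : nat) (u : 'rV[R]_l) : dot 0 u = 0.
Proof. by rewrite /dot big1// => i _; rewrite mxE mul0r. Qed.

Lemma dot0r (R : realType) (l : nat) (u : 'rV[R]_l) : dot u 0 = 0.
Proof. by rewrite /dot big1// => i _; rewrite mxE mulr0. Qed.

(** The two one-sided fluxes use different traces of the bottom, hence the
    uniformity in [b]. *)
Lemma lax_friedrichs_const (R : realType) (l : nat)
    (F : R -> 'rV[R]_l -> 'rV[R]_l) (alpha bm bp : R) (c f : 'rV[R]_l) :
  (forall b, F b c = f) -> lax_friedrichs F alpha bm bp c c = f.
Proof.
move=> Fc; rewrite /lax_friedrichs !Fc subrr scaler0 subr0.
by apply/rowP => i; rewrite !mxE; field.
Qed.

Lemma path_integral_const (R : realType) (l : nat)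
    (G : R -> 'rV[R]_l -> 'M[R]_l) (bm bp : R) (c : 'rV[R]_l) :
  path_integral G bm bp c c = 0.
Proof.
apply/rowP => i; rewrite !mxE; apply: Rintegral_eq0 => t _.
rewrite (_ : (fun t : R => c + t *: (c - c)) = cst c).
  by rewrite derive1_cst mul0mx mxE.
by apply/funext => s; rewrite subrr scaler0 addr0.
Qed.

(** The product [dot] at the level of polynomials, over any coefficient ring so
    that it serves for one and for two variables. *)
Definition dotp (A : comNzRingType) (l : nat) (p q : 'rV[A]_l) : A :=
  \sum_i p 0 i * q 0 i.

Lemma dotpBl (A : comNzRingType) (l : nat) (p p' q : 'rV[A]_l) :
  dotp (p - p') q = dotp p q - dotp p' q.
Proof.
by rewrite /dotp -sumrB; apply: eq_bigr => i _; rewrite !mxE mulrBl.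
Qed.

Lemma dotp_polyC_deriv (A : comNzRingType) (l : nat) (c : 'rV[A]_l)
    (q : 'rV[{poly A}]_l) :
  (dotp (map_mx polyC c) q)^`() = dotp (map_mx polyC c) (map_mx (@deriv A) q).
Proof.
rewrite /dotp raddf_sum; apply: eq_bigr => i _ /=.
by rewrite !mxE derivM derivC mul0r add0r.
Qed.

Lemma dot_ev1 (R : realType) (l : nat) (p q : 'rV[{poly R}]_l) (x : R) :
  dot (ev1 p x) (ev1 q x) = (dotp p q).[x].
Proof.
by rewrite /dot /dotp horner_sum; apply: eq_bigr => i _; rewrite !mxE hornerM.
Qed.

Lemma ev1_polyC (R : realType) (l : nat) (c : 'rV[R]_l) (x : R) :
  ev1 (map_mx polyC c) x = c.
Proof. by apply/rowP => i; rewrite !mxE hornerC. Qed.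

Lemma dot_const_ev1 (R : realType) (l : nat) (c : 'rV[R]_l)
    (q : 'rV[{poly R}]_l) (x : R) :
  dot c (ev1 q x) = (dotp (map_mx polyC c) q).[x].
Proof. by rewrite -dot_ev1 ev1_polyC. Qed.

Lemma dot_const_dev1 (R : realType) (l : nat) (c : 'rV[R]_l)
    (q : 'rV[{poly R}]_l) (x : R) :
  dot c (dev1 q x) = (dotp (map_mx polyC c) q)^`().[x].
Proof.
rewrite dotp_polyC_deriv -dot_const_ev1; congr dot.
by apply/rowP => i; rewrite !mxE.
Qed.

(** Equality as polynomials, and not only of values on the interval, gives
    access to the formal derivative. *)
Lemma ev1_const_on_itv (R : realType) (l : nat) (p : 'rV[{poly R}]_l)
    (c : 'rV[R]_l) (a b : R) : a < b ->
  (forall x, x \in `[a, b] -> ev1 p x = c) -> p = map_mx polyC c.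
Proof.
move=> ab pc; apply/rowP => i; apply/eqP; rewrite -subr_eq0; apply/eqP.
apply: (poly_eq0_on_itv (@inj_id R) ab) => x /pc /rowP/(_ i).
by rewrite !mxE hornerD hornerN hornerC => ->; rewrite subrr.
Qed.

Lemma dev1_polyC (R : realType) (l : nat) (c : 'rV[R]_l) (x : R) :
  dev1 (map_mx polyC c) x = 0.
Proof. by apply/rowP => i; rewrite !mxE derivC horner0. Qed.

(** * The one-dimensional scheme *)

Lemma seg_lft (R : realType) (n : nat) (x : 'I_n.+1 -> R) (j : 'I_n) :
  x (lft j) < x (rgt j) -> seg x j (x (lft j)).
Proof. by move=> /ltW ?; rewrite /seg/= in_itv/= lexx. Qed.

Lemma seg_rgt (R : realType) (n : nat) (x : 'I_n.+1 -> R) (j : 'I_n) :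
  x (lft j) < x (rgt j) -> seg x j (x (rgt j)).
Proof. by move=> /ltW ?; rewrite /seg/= in_itv/= lexx andbT. Qed.

Lemma vm1_const (R : realType) (nx : nat) (P : problem1 R nx)
    (v : bpoly1 R nx) (c : 'rV[R]_4) (a : 'I_nx.+1) :
  (forall j x, seg (node1 P) j x -> ev1 (v j) x = c) -> vm1 P v a = c.
Proof.
move=> vc; rewrite /vm1; case: unliftP => [j ->|_].
  by apply: vc; apply: seg_rgt; exact: node1_lt.
by have [] := ext1_const vc.
Qed.

Lemma vp1_const (R : realType) (nx : nat) (P : problem1 R nx)
    (v : bpoly1 R nx) (c : 'rV[R]_4) (a : 'I_nx.+1) :
  (forall j x, seg (node1 P) j x -> ev1 (v j) x = c) -> vp1 P v a = c.
Proof.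
move=> vc; rewrite /vp1; case: unliftP => [j ->|_].
  by apply: vc; apply: seg_lft; exact: node1_lt.
by have [] := ext1_const vc.
Qed.

Lemma flux_still_water (R : realType) (g b H W : R) :
  flux g b (vec 4 [:: H; 0; W; 0]) =
  vec 4 [:: 0; 2^-1 * g * H ^+ 2; 0; 2^-1 * g * W ^+ 2].
Proof. by rewrite /flux !mxE/= expr0n/= !mul0r !add0r. Qed.

(** Only the flux terms survive, and with [p = f . phi] they add up to
    [(p(b) - p(a)) - p(b) + p(a)]. *)
Lemma rhs1_const (R : realType) (g r : R) (nx : nat) (P : problem1 R nx)
    (j : 'I_nx) (v phi : bpoly1 R nx) (c f : 'rV[R]_4) :
  (forall b, flux g b c = f) ->
  (forall j x, seg (node1 P) j x -> ev1 (v j) x = c) ->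
  rhs1 g r P j v phi = 0.
Proof.
move=> fluxc vc; rewrite /rhs1 /fhat1 /gpath1.
have -> : v j = map_mx polyC c.
  by apply: (ev1_const_on_itv (node1_lt P j)) => x; exact: vc.
rewrite !(vm1_const _ vc) !(vp1_const _ vc).
rewrite !(lax_friedrichs_const _ _ _ fluxc) !path_integral_const.
rewrite !dot0r !mulr0 !subr0 [X in _ - X]Rintegral_eq0 ?subr0; last first.
  by move=> x _; rewrite dev1_polyC mul0mx dot0l.
under eq_Rintegral do rewrite ev1_polyC fluxc dot_const_dev1.
rewrite Rintegral_deriv ?node1_lt// !dot_const_ev1.
by rewrite addrAC subrK subrr.
Qed.

(** The discrete space contains the difference of [u] and [v], whose squared
    norm on each cell is then a difference of equal moments. *)
Lemma mass1_sep (R : realType) (nx k : nat) (P : problem1 R nx)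
    (u v : bpoly1 R nx) : Vh1 k u -> Vh1 k v ->
  (forall j phi, Vh1 k phi -> mass1 P j u phi = mass1 P j v phi) -> u = v.
Proof.
move=> Vu Vv muv; apply/funext => j; apply/eqP; rewrite -subr_eq0; apply/eqP.
pose phi : bpoly1 R nx := fun j => u j - v j.
have Vphi : Vh1 k phi.
  move=> i l; rewrite !mxE (leq_trans (size_polyD _ _))// size_polyN geq_max.
  by rewrite Vu Vv.
have sq0 : dotp (phi j) (phi j) = 0.
  apply: (Rintegral_horner_eq0 (node1_lt P j)) => [x _|].
    by rewrite -dot_ev1 sumr_ge0// => i _; exact: sqr_ge0.
  rewrite {1}/phi dotpBl; under eq_Rintegral do rewrite hornerD hornerN.
  rewrite (@RintegralB _ _ _ lebesgue_measure)//; [|exact: integrable_horner..].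
  apply/eqP; rewrite subr_eq0; apply/eqP; move: (muv j phi Vphi).
  rewrite /mass1; under eq_Rintegral do rewrite dot_ev1.
  by under [in RHS]eq_Rintegral do rewrite dot_ev1.
apply: (etrans (ev1_const_on_itv (c := 0) (node1_lt P j) _)) => [x _|].
  apply/rowP => i; rewrite [RHS]mxE; apply/eqP; rewrite -sqrf_eq0.
  have /eqP := congr1 (horner^~ x) sq0; rewrite -dot_ev1 horner0.
  rewrite psumr_eq0 => [/allP/(_ i (mem_index_enum i))//|l _].
  exact: sqr_ge0.
by apply/rowP => i; rewrite !mxE.
Qed.

(** * The two-dimensional scheme *)

Lemma dot_ev2 (R : realType) (l : nat) (p q : 'rV[{poly {poly R}}]_l)
    (x y : R) :
  dot (ev2 p x y) (ev2 q x y) = (dotp p q).[x, y].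
Proof.
by rewrite /dot /dotp !horner_sum; apply: eq_bigr => i _; rewrite !mxE !hornerM.
Qed.

Lemma ev2_polyC (R : realType) (l : nat) (c : 'rV[R]_l) (x y : R) :
  ev2 (map_mx polyC (map_mx polyC c)) x y = c.
Proof. by apply/rowP => i; rewrite !mxE !hornerC. Qed.

Lemma dot_const_ev2 (R : realType) (l : nat) (c : 'rV[R]_l)
    (q : 'rV[{poly {poly R}}]_l) (x y : R) :
  dot c (ev2 q x y) = (dotp (map_mx polyC (map_mx polyC c)) q).[x, y].
Proof. by rewrite -dot_ev2 ev2_polyC. Qed.

Lemma dot_const_dxev2 (R : realType) (l : nat) (c : 'rV[R]_l)
    (q : 'rV[{poly {poly R}}]_l) (x y : R) :
  dot c (dxev2 q x y) =
  (dotp (map_mx polyC (map_mx polyC c)) q)^`().[x, y].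
Proof.
rewrite dotp_polyC_deriv -dot_const_ev2; congr dot.
by apply/rowP => i; rewrite !mxE.
Qed.

Lemma dot_const_dyev2 (R : realType) (l : nat) (c : 'rV[R]_l)
    (q : 'rV[{poly {poly R}}]_l) (x y : R) :
  dot c (dyev2 q x y) =
  (map_poly (@deriv R) (dotp (map_mx polyC (map_mx polyC c)) q)).[x, y].
Proof.
rewrite horner2_deriv_inner /dotp horner_sum raddf_sum horner_sum.
apply: eq_bigr => i _; rewrite !mxE horner2_deriv_inner hornerCM /=.
by rewrite derivM derivC mul0r add0r hornerCM.
Qed.

Lemma ev2_const_on_rectangle (R : realType) (l : nat)
    (p : 'rV[{poly {poly R}}]_l) (c : 'rV[R]_l) (a b a' b' : R) :
  a < b -> a' < b' ->
  (forall x y, x \in `[a, b] -> y \in `[a', b'] -> ev2 p x y = c) ->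
  p = map_mx polyC (map_mx polyC c).
Proof.
move=> ab ab' pc; apply/rowP => i; apply/eqP; rewrite -subr_eq0; apply/eqP.
apply: (poly_eq0_on_itv (@polyC_inj R) ab) => x xab.
apply: (poly_eq0_on_itv (@inj_id R) ab') => y /(pc x y xab) /rowP/(_ i).
by rewrite !mxE !hornerD !hornerN !hornerC => ->; rewrite subrr.
Qed.

Lemma dxev2_polyC (R : realType) (l : nat) (c : 'rV[R]_l) (x y : R) :
  dxev2 (map_mx polyC (map_mx polyC c)) x y = 0.
Proof. by apply/rowP => i; rewrite !mxE derivC !horner0. Qed.

Lemma dyev2_polyC (R : realType) (l : nat) (c : 'rV[R]_l) (x y : R) :
  dyev2 (map_mx polyC (map_mx polyC c)) x y = 0.
Proof.
by apply/rowP => i; rewrite !mxE horner2_deriv_inner hornerC derivC horner0.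
Qed.

Definition const2 (R : realType) (nx ny : nat) (P : problem2 R nx ny)
    (v : bpoly2 R nx ny) (c : 'rV[R]_6) : Prop :=
  forall i j x y, seg (nodex P) i x -> seg (nodey P) j y ->
    ev2 (v i j) x y = c.

Lemma vmx2_const (R : realType) (nx ny : nat) (P : problem2 R nx ny)
    (v : bpoly2 R nx ny) (c : 'rV[R]_6) (a : 'I_nx.+1) (j : 'I_ny) (y : R) :
  const2 P v c -> seg (nodey P) j y -> vmx2 P v a j y = c.
Proof.
move=> vc yj; rewrite /vmx2; case: unliftP => [i ->|_].
  by apply: vc => //; apply: seg_rgt; exact: nodex_lt.
by have [/(_ j y yj)[]] := ext2_const vc.
Qed.

Lemma vpx2_const (R : realType) (nx ny : nat) (P : problem2 R nx ny)
    (v : bpoly2 R nx ny) (c : 'rV[R]_6) (a : 'I_nx.+1) (j : 'I_ny) (y : R) :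
  const2 P v c -> seg (nodey P) j y -> vpx2 P v a j y = c.
Proof.
move=> vc yj; rewrite /vpx2; case: unliftP => [i ->|_].
  by apply: vc => //; apply: seg_lft; exact: nodex_lt.
by have [/(_ j y yj)[]] := ext2_const vc.
Qed.

Lemma vmy2_const (R : realType) (nx ny : nat) (P : problem2 R nx ny)
    (v : bpoly2 R nx ny) (c : 'rV[R]_6) (i : 'I_nx) (a : 'I_ny.+1) (x : R) :
  const2 P v c -> seg (nodex P) i x -> vmy2 P v i a x = c.
Proof.
move=> vc xi; rewrite /vmy2; case: unliftP => [j ->|_].
  by apply: vc => //; apply: seg_rgt; exact: nodey_lt.
by have [_ /(_ i x xi)[]] := ext2_const vc.
Qed.

Lemma vpy2_const (R : realType) (nx ny : nat) (P : problem2 R nx ny)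
    (v : bpoly2 R nx ny) (c : 'rV[R]_6) (i : 'I_nx) (a : 'I_ny.+1) (x : R) :
  const2 P v c -> seg (nodex P) i x -> vpy2 P v i a x = c.
Proof.
move=> vc xi; rewrite /vpy2; case: unliftP => [j ->|_].
  by apply: vc => //; apply: seg_lft; exact: nodey_lt.
by have [_ /(_ i x xi)[]] := ext2_const vc.
Qed.

Lemma flux_x_still_water (R : realType) (g b H W : R) :
  flux_x g b (vec 6 [:: H; 0; 0; W; 0; 0]) =
  vec 6 [:: 0; 2^-1 * g * H ^+ 2; 0; 0; 2^-1 * g * W ^+ 2; 0].
Proof. by rewrite /flux_x !mxE/= expr0n/= !mul0r !add0r. Qed.

Lemma flux_y_still_water (R : realType) (g b H W : R) :
  flux_y g b (vec 6 [:: H; 0; 0; W; 0; 0]) =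
  vec 6 [:: 0; 0; 2^-1 * g * H ^+ 2; 0; 0; 2^-1 * g * W ^+ 2].
Proof. by rewrite /flux_y !mxE/= expr0n/= !mul0r !add0r. Qed.

Lemma Rintegral_const_dxev2 (R : realType) (l : nat) (f : 'rV[R]_l)
    (q : 'rV[{poly {poly R}}]_l) (a b c d : R) : a < b ->
  \int[(@lebesgue_measure R \x @lebesgue_measure R)%E]_(z in
      `[a, b] `*` `[c, d]) dot f (dxev2 q z.1 z.2) =
  \int[lebesgue_measure]_(y in `[c, d])
    (dot f (ev2 q b y) - dot f (ev2 q a y)).
Proof.
move=> ab; under eq_Rintegral do rewrite dot_const_dxev2.
rewrite Rintegral_rectangle_derivx//; apply: eq_Rintegral => y _.
by rewrite !dot_const_ev2.
Qed.

Lemma Rintegral_const_dyev2 (R : realType) (l : nat) (f : 'rV[R]_l)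
    (q : 'rV[{poly {poly R}}]_l) (a b c d : R) : c < d ->
  \int[(@lebesgue_measure R \x @lebesgue_measure R)%E]_(z in
      `[a, b] `*` `[c, d]) dot f (dyev2 q z.1 z.2) =
  \int[lebesgue_measure]_(x in `[a, b])
    (dot f (ev2 q x d) - dot f (ev2 q x c)).
Proof.
move=> cd; under eq_Rintegral do rewrite dot_const_dyev2.
rewrite Rintegral_rectangle_derivy//; apply: eq_Rintegral => x _.
by rewrite !dot_const_ev2.
Qed.

(** In each direction the volume integral of the constant flux equals the
    difference of the integrals over the two opposite edges. *)
Lemma rhs2_const (R : realType) (g r : R) (nx ny : nat) (P : problem2 R nx ny)
    (K : 'I_nx * 'I_ny) (v phi : bpoly2 R nx ny) (c fx fy : 'rV[R]_6) :
  (forall b, flux_x g b c = fx) -> (forall b, flux_y g b c = fy) ->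
  const2 P v c -> rhs2 g r P K v phi = 0.
Proof.
case: K => i j flux_xc flux_yc vc; rewrite /rhs2 /cell_int2/=.
have -> : v i j = map_mx polyC (map_mx polyC c).
  by apply: (ev2_const_on_rectangle (nodex_lt P i) (nodey_lt P j)) => x y;
    exact: vc.
have gx0 a y : seg (nodey P) j y -> gpathx2 g r P v a j y = 0.
  move=> yj; rewrite /gpathx2 (vmx2_const a vc yj) (vpx2_const a vc yj).
  exact: path_integral_const.
have gy0 a x : seg (nodex P) i x -> gpathy2 g r P v i a x = 0.
  move=> xi; rewrite /gpathy2 (vmy2_const a vc xi) (vpy2_const a vc xi).
  exact: path_integral_const.
have fxE a y : seg (nodey P) j y -> fhatx2 g P v a j y = fx.
  move=> yj; rewrite /fhatx2 (vmx2_const a vc yj) (vpx2_const a vc yj).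
  exact: lax_friedrichs_const.
have fyE a x : seg (nodex P) i x -> fhaty2 g P v i a x = fy.
  move=> xi; rewrite /fhaty2 (vmy2_const a vc xi) (vpy2_const a vc xi).
  exact: lax_friedrichs_const.
rewrite [X in _ - X]Rintegral_eq0 ?subr0; last first.
  by move=> x xi; rewrite !gy0// !dot0r !mulr0 addr0.
rewrite [X in _ - X]Rintegral_eq0 ?subr0; last first.
  by move=> z _; rewrite dyev2_polyC mul0mx dot0l.
rewrite [X in _ - X]Rintegral_eq0 ?subr0; last first.
  by move=> y yj; rewrite !gx0// !dot0r !mulr0 addr0.
rewrite [X in _ - X]Rintegral_eq0 ?subr0; last first.
  by move=> z _; rewrite dxev2_polyC mul0mx dot0l.
under eq_Rintegral do rewrite ev2_polyC flux_xc.
under [X in _ + X - _]eq_Rintegral do rewrite ev2_polyC flux_yc.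
rewrite Rintegral_const_dxev2 ?nodex_lt// Rintegral_const_dyev2 ?nodey_lt//.
under [X in _ - X + _ - _]eq_Rintegral => y /set_mem yj do rewrite !fxE//.
under [X in _ + _ - X]eq_Rintegral => x /set_mem xi do rewrite !fyE//.
by rewrite subrr add0r subrr.
Qed.

(** The argument of [mass1_sep], on rectangles; bounding the total degree also
    defines a space closed under differences. *)
Lemma mass2_sep (R : realType) (nx ny k : nat) (P : problem2 R nx ny)
    (u v : bpoly2 R nx ny) : Vh2 k u -> Vh2 k v ->
  (forall K phi, Vh2 k phi -> mass2 P K u phi = mass2 P K v phi) -> u = v.
Proof.
move=> Vu Vv muv; apply/funext => i; apply/funext => j.
apply/eqP; rewrite -subr_eq0; apply/eqP.
pose phi : bpoly2 R nx ny := fun i j => u i j - v i j.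
have Vphi : Vh2 k phi.
  by move=> i' j' l a b ab; rewrite !mxE !coefB Vu ?Vv ?subrr.
have sq0 : dotp (phi i j) (phi i j) = 0.
  apply: (Rintegral_horner2_eq0 (nodex_lt P i) (nodey_lt P j)) => [x y _ _|].
    by rewrite -dot_ev2 sumr_ge0// => l _; exact: sqr_ge0.
  rewrite {1}/phi dotpBl.
  under eq_Rintegral do rewrite !hornerD !hornerN.
  rewrite (@RintegralB _ _ _ (lebesgue_measure \x lebesgue_measure)%E)//;
    [|exact: measurableX|exact: integrable_horner2..].
  apply/eqP; rewrite subr_eq0; apply/eqP; move: (muv (i, j) phi Vphi).
  rewrite /mass2 /cell_int2/=; under eq_Rintegral do rewrite dot_ev2.
  by under [in RHS]eq_Rintegral do rewrite dot_ev2.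
apply: etrans (ev2_const_on_rectangle (c := 0) (nodex_lt P i) (nodey_lt P j)
  _) _.
  move=> x y _ _.
  apply/rowP => l; rewrite [RHS]mxE; apply/eqP; rewrite -sqrf_eq0.
  have /eqP := congr1 (fun p => p.[x, y]) sq0; rewrite -dot_ev2 !horner0.
  rewrite psumr_eq0 => [/allP/(_ l (mem_index_enum l))//|m _].
  exact: sqr_ge0.
by apply/rowP => l; rewrite !mxE.
Qed.

(** * Exactness for still water *)

Theorem theorem3p2 (R : realType) (g r : R) (k : nat)
    (g_gt0 : 0 < g) (r_gt0 : 0 < r) (r_lt1 : r < 1) :
  (forall (nx : nat) (P : problem1 R nx) (dt : nat -> R)
          (v v1 v2 : nat -> bpoly1 R nx) (H W : R),
     (forall n, 0 < dt n) ->
     Vh1 k (v 0%N) ->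
     (forall n, ssprk3_step (Vh1 k) (mass1 P) (rhs1 g r P) (dt n)
                  (v n) (v1 n) (v2 n) (v n.+1)) ->
     0 < H ->
     (forall j x, seg (node1 P) j x -> bot1 P j x < W) ->
     botL1 P < W -> botR1 P < W ->
     (forall j x, seg (node1 P) j x ->
        ev1 (v 0%N j) x = vec 4 [:: H; 0; W; 0]) ->
     forall n, v n = v 0%N)
  /\
  (forall (nx ny : nat) (P : problem2 R nx ny) (dt : nat -> R)
          (v v1 v2 : nat -> bpoly2 R nx ny) (H W : R),
     (forall n, 0 < dt n) ->
     Vh2 k (v 0%N) ->
     (forall n, ssprk3_step (Vh2 k) (mass2 P) (rhs2 g r P) (dt n)
                  (v n) (v1 n) (v2 n) (v n.+1)) ->
     0 < H ->
     (forall i j x y, seg (nodex P) i x -> seg (nodey P) j y ->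
        bot2 P i j x y < W) ->
     (forall j y, seg (nodey P) j y -> botL2 P j y < W /\ botR2 P j y < W) ->
     (forall i x, seg (nodex P) i x -> botD2 P i x < W /\ botU2 P i x < W) ->
     (forall i j x y, seg (nodex P) i x -> seg (nodey P) j y ->
        ev2 (v 0%N i j) x y = vec 6 [:: H; 0; 0; W; 0; 0]) ->
     forall n, v n = v 0%N).
Proof.
split=> [nx P dt v v1 v2 H W _ V0 step _ _ _ _ v0c
        |nx ny P dt v v1 v2 H W _ V0 step _ _ _ _ v0c].
  elim=> // n IH; rewrite -[RHS]IH.
  apply: ssprk3_step_stationary (step n) => [u Vu|j phi]; rewrite IH.
    exact: mass1_sep.
  exact: rhs1_const (fun b => flux_still_water g b H W) v0c.
elim=> // n IH; rewrite -[RHS]IH.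
apply: ssprk3_step_stationary (step n) => [u Vu|K phi]; rewrite IH.
  exact: mass2_sep.
exact: rhs2_const (fun b => flux_x_still_water g b H W)
  (fun b => flux_y_still_water g b H W) v0c.
Qed.
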